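(* Let $k\ge1$ be an integer, $\varepsilon\in(0,1)$, $\alpha,\beta\ge0$, $C(L,T)=\alpha L+\beta T$, and suppose $m\ge n\ge\frac{100k^2}{\varepsilon}$. Then for the C-CPPG with objective $C$ a mixed up-and-down path (possibly consisting of a single type-$d$ up-and-down path with $d\in\{2,4,\dots,2k\}$) provides a $\rho$-approximate solution, where $\rho=\frac98+\varepsilon$ if $k\ge3$, $\rho=\frac32+\varepsilon$ if $k=1$, and $\rho=\frac76+\varepsilon$ if $k=2$: there is such a path which is a covering path and whose path length $L'$ and stop count $T'$ satisfy $C(L',T')\le\rho\,C(L,T)$ for every covering path with path length $L$ and stop count $T$.
   Context: Let $m\ge n\ge 1$ be integers, $D=\{(x,y)\in\mathbb{R}^2: 0\le x\le n,\ 0\le y\le m\}$, $D_{int}=D\cap\mathbb{Z}^2$. Distances are $\ell_1$ distances. C-CPPG with integer coverage radius $k$: a covering path is a finite sequence $F_1,\dots,F_T$ of distinct points of $D_{int}$ (stops) such that every point of $D$ is within $\ell_1$ distance $k$ of some $F_i$; its stop count is $T$ and its path length is $\sum_{i}\|F_{i+1}-F_i\|_1$ (or the length of a prescribed path visiting the stops in this order). The problem is to minimize $C(\text{path length},\text{stop count})$ over covering paths. Type-$d$ up-and-down path on a rectangle of width $w$ and height $m$ (with lower left corner at the origin after translation), $0<d\le 2k$: put $r=2k-\frac d2$. It has vertical traversals, from height $0$ to height $m$, at $x=0,r,2r,\dots,\lfloor w/r\rfloor r$, and, if $w/r$ is not an integer, a last traversal at $x=w$. It goes up the first traversal, along the top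 side to the second, down the second, along the bottom side to the third, and so on. On the 1st, 3rd, ... traversals there are stops at heights $jd\le m$ ($j=0,1,\dots$); on the 2nd, 4th, ... traversals at heights $jd+\frac d2\le m$ ($j=0,1,\dots$); every traversal also has a stop at height $m$. Type-$(d,\gamma)$ mixed up-and-down path, $d$ even with $2\le d\le 2k-2$, $\gamma\in[0,1)$: divide $D$ into a left rectangle of width $\lceil\gamma n\rceil$ and a right rectangle of width $\lceil(1-\gamma)n\rceil$, both of height $m$ (if these widths add to $n+1$ the two overlap in a strip of width 1). Cover the left one by a type-$d$ up-and-down path and the right one by a type-$(d+2)$ up-and-down path, and connect the two paths by a segment at the common boundary. *)

(* Defs.v *)
From HB Require Import structures.
From mathcomp Require Import all_boot all_order all_algebra.
From mathcomp Require Import reals.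

Set Implicit Arguments.
Unset Strict Implicit.
Unset Printing Implicit Defensive.

Import Order.TTheory GRing.Theory Num.Theory.
Local Open Scope ring_scope.

Definition l1 (R : realType) (p q : R * R) : R :=
  `|p.1 - q.1| + `|p.2 - q.2|.

Definition emb (R : realType) (p : int * int) : R * R := (p.1%:~R, p.2%:~R).

Definition in_D (R : realType) (n m : nat) (p : R * R) : bool :=
  (0 <= p.1 <= n%:R) && (0 <= p.2 <= m%:R).

Definition in_Dint (n m : nat) (p : int * int) : bool :=
  (0 <= p.1 <= n%:Z) && (0 <= p.2 <= m%:Z).

(* A sequence of stops together with the polyline that is followed to visit
   them, given by its successive vertices.  The vertices include the stops; with
   [route = map emb stops] the path length is the sum of the distances between
   consecutive stops. *)
Record stop_path (R : realType) := StopPath {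
  stops : seq (int * int);
  route : seq (R * R)
}.

Definition path_length (R : realType) (P : stop_path R) : R :=
  \sum_(0 <= i < (size (route P)).-1) l1 (route P)`_i.+1 (route P)`_i.

Definition stop_count (R : realType) (P : stop_path R) : nat := size (stops P).

Definition covering_path (R : realType) (k n m : nat) (P : stop_path R) : Prop :=
  [/\ uniq (stops P),
      all (in_Dint n m) (stops P),
      forall p : R * R, in_D n m p ->
        exists2 q, q \in stops P & l1 p (emb R q) <= k%:R
    & subseq (map (emb R) (stops P)) (route P)].

(* The heights h <= m of the form j * d + s (for s < d), and m, increasingly. *)
Definition heights (m d s : nat) : seq nat :=
  [seq h <- iota 0 m.+1 | (h == s %[mod d])%N || (h == m)].

(* Only even d are used, so that d / 2 and the spacing are integers. *)
Definition spacing (k d : nat) : nat := (2 * k - d./2)%N.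

Definition abscissae (w r : nat) : seq nat :=
  [seq (i * r)%N | i <- iota 0 (w %/ r).+1] ++ (if (r %| w)%N then [::] else [:: w]).

(* Visits the abscissae in [xs] in turn, the i-th one (from 0) at the heights
   [hs i], alternately upwards and downwards. *)
Definition serpentine (xs : seq nat) (hs : nat -> seq nat) : seq (int * int) :=
  flatten (mkseq (fun i =>
    let c := [seq ((nth 0%N xs i)%:Z, h%:Z) | h <- hs i] in
    if odd i then rev c else c) (size xs)).

(* [x0] is the abscissa of the lower left corner of the rectangle, [w] its
   width and [m] its height. *)
Definition up_down_stops (k m d x0 w : nat) : seq (int * int) :=
  serpentine [seq (x0 + x)%N | x <- abscissae w (spacing k d)]
    (fun i => heights m d (if odd i then d./2 else 0%N)).

(* Every traversal goes all the way to height 0, even if it has no stop there. *)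
Definition up_down_route (k m d x0 w : nat) : seq (int * int) :=
  serpentine [seq (x0 + x)%N | x <- abscissae w (spacing k d)]
    (fun i => 0%N :: heights m d (if odd i then d./2 else 0%N)).

Definition up_down (R : realType) (k n m d : nat) : stop_path R :=
  StopPath (up_down_stops k m d 0 n) (map (emb R) (up_down_route k m d 0 n)).

Definition left_width (R : realType) (n : nat) (g : R) : nat :=
  `|Num.ceil (g * n%:R)|%N.

Definition right_width (R : realType) (n : nat) (g : R) : nat :=
  `|Num.ceil ((1 - g) * n%:R)|%N.

(* The two halves may share stops on their common boundary or in the overlap;
   [undup] counts such a stop once.  Concatenating the two routes adds the
   segment from the end of the left path to the start of the right path. *)
Definition mixed_up_down (R : realType) (k n m d : nat) (g : R) : stop_path R :=
  let a := left_width n g in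
  let b := right_width n g in
  StopPath
    (undup (up_down_stops k m d 0 a ++ up_down_stops k m d.+2 (n - b) b))
    (map (emb R) (up_down_route k m d 0 a ++ up_down_route k m d.+2 (n - b) b)).

Definition is_mixed_up_down (R : realType) (k n m : nat) (P : stop_path R) : Prop :=
  (exists d : nat, [/\ ~~ odd d, (2 <= d <= 2 * k)%N & P = up_down R k n m d]) \/
  (exists (d : nat) (g : R),
     [/\ ~~ odd d, (2 <= d <= 2 * k - 2)%N, 0 <= g < 1
       & P = mixed_up_down k n m d g]).

Definition cost (R : realType) (alpha beta : R) (P : stop_path R) : R :=
  alpha * path_length P + beta * (stop_count P)%:R.

Definition approx_ratio (R : realType) (k : nat) (eps : R) : R :=
  if k == 1%N then 3 / 2 + eps
  else if k == 2%N then 7 / 6 + eps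
  else 9 / 8 + eps.

(* Main.v *)
(* The objective is linear, so no genuine mixture is needed: a type-d path with
   the best even d suffices.

   Lower bound.  Call gain k s = (2k)^2 - (2k-s)^2 (truncated differences).  In
   the coordinates x+y, x-y the radius-k ball of a stop is a square that contains
   exactly (2k)^2 midpoints of lattice edges, and the balls of two stops at
   distance s share at least (2k-s)^2 of them, so that each step of length s
   covers at most gain k s new midpoints.  The region contains 2nm of them,
   whence sum_i gain k s_i >= 2nm - 4k^2 for the steps s_i of a covering path.
   If c * gain k s <= alpha * s + beta for all s >= 1, the cost is therefore at
   least c(2nm - 4k^2).

   Upper bound.  Up to boundary terms of relative order k^2/n, the cost of the
   type-d path is 2nm(alpha * d + beta) / gain k d, so that only odd steps s lose
   a factor.  For s >= 3 averaging over d = s-1, s+1 loses gain/(gain-1) <= 9/8;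
   for s = 1, taking d = 2 loses at most (4k-1)/(4k-2). *)
Require Import Defs.
From mathcomp Require Import all_boot all_order all_algebra.
From mathcomp Require Import reals.
From mathcomp Require Import zify ring lra.

Set Implicit Arguments.
Unset Strict Implicit.
Unset Printing Implicit Defensive.

Import Order.TTheory GRing.Theory Num.Theory.
Local Open Scope ring_scope.

(** * Lengths of polygonal lines *)

Section PolygonalLength.
Variable R : realType.
Implicit Types (p q : R * R) (s t : seq (R * R)).

Lemma l1_ge0 p q : 0 <= l1 p q.
Proof. by rewrite addr_ge0. Qed.

Lemma l1_triangle p q z : l1 p z <= l1 p q + l1 q z.
Proof.
rewrite /l1; have := ler_distD q.1 p.1 z.1; have := ler_distD q.2 p.2 z.2; lra.
Qed.

(** Structural recursion replaces the indexed sum of [path_length]; [path_lengthE] relates the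
    two. *)
Fixpoint len_from p s : R := if s is q :: s' then l1 q p + len_from q s' else 0.

Definition len s : R := if s is p :: s' then len_from p s' else 0.

Lemma len_from_ge0 p s : 0 <= len_from p s.
Proof. by elim: s p => //= q s IHs p; rewrite addr_ge0 ?l1_ge0. Qed.

Lemma len_le_from p s : len s <= len_from p s.
Proof. by case: s => //= q s; rewrite lerDr l1_ge0. Qed.

Lemma len_ge0 s : 0 <= len s.
Proof. by case: s => //= p s; exact: len_from_ge0. Qed.

Lemma len_from_detour p q s : len_from p s <= l1 q p + len_from q s.
Proof.
case: s => [|z s] /=; first by rewrite addr0 l1_ge0.
by rewrite addrA lerD2r addrC l1_triangle.
Qed.

Lemma len_from_subseq p s t : subseq s t -> len_from p s <= len_from p t.
Proof.
elim: t s p => [|q t IHt] [|z s] p //=; first by rewrite addr_ge0 ?l1_ge0 ?len_from_ge0.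
case: eqP => [-> /IHt le_st|_ /IHt le_st]; first by rewrite lerD2l.
by rewrite (le_trans (len_from_detour p q (z :: s))) ?lerD2l.
Qed.

(** By the triangle inequality, skipping vertices never lengthens a polyline. This lets the lower
    bound replace a prescribed route by direct hops between stops. *)
Lemma len_subseq s t : subseq s t -> len s <= len t.
Proof.
case: t => [|q t] /=; first by case: s.
case: s => [|p s]; first by rewrite len_from_ge0.
case: eqP => [->|_] /(len_from_subseq _); first exact.
by move=> le_st; rewrite (le_trans (len_le_from q _)).
Qed.

Lemma path_lengthE (P : stop_path R) : path_length P = len (route P).
Proof.
rewrite /path_length; case: (route P) => [|p s] /=; first by rewrite big_nil.
elim: s p => [|q s IHs] p /=; first by rewrite big_nil.
by rewrite big_nat_recl //= -IHs.
Qed.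

Lemma len_from_cat p s t : len_from p (s ++ t) = len_from p s + len_from (last p s) t.
Proof. by elim: s p => /= [|q s IHs] p; rewrite ?add0r // IHs addrA. Qed.

Lemma len_from_rcons p s q : len_from p (rcons s q) = len_from p s + l1 q (last p s).
Proof. by rewrite -cats1 len_from_cat /= addr0. Qed.

Lemma l1C p q : l1 p q = l1 q p.
Proof. by rewrite /l1 !(distrC p.1, distrC p.2). Qed.

Lemma len_rcons2 s p q : len (rcons (rcons s p) q) = len (rcons s p) + l1 q p.
Proof. by case: s => [|z s] /=; rewrite ?addr0 ?add0r // len_from_rcons last_rcons. Qed.

Lemma len_rev s : len (rev s) = len s.
Proof.
case: s => // p s; elim: s p => // q s IHs p /=.
by rewrite !rev_cons len_rcons2 -rev_cons IHs /= addrC l1C.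
Qed.

Lemma len_cat p s q t :
  len (p :: s ++ q :: t) = len (p :: s) + l1 q (last p s) + len (q :: t).
Proof. by rewrite /= len_from_cat /= addrA. Qed.

Lemma len_from_vertical (x y : R) (hs : seq R) :
  path <=%R y hs -> len_from (x, y) [seq (x, h) | h <- hs] = last y hs - y.
Proof.
elim: hs y => [|h hs IHhs] y /=; first by rewrite subrr.
case/andP=> le_yh /IHhs ->.
by rewrite /l1 /= subrr normr0 add0r ger0_norm ?subr_ge0 // addrC subrKA.
Qed.
End PolygonalLength.

(** * Serpentines *)

Lemma serpentine_rcons (xs : seq nat) (x : nat) (hs : nat -> seq nat) :
  serpentine (rcons xs x) hs = serpentine xs hs ++
    (let c := [seq (x%:Z, h%:Z) | h <- hs (size xs)] in
     if odd (size xs) then rev c else c).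
Proof.
rewrite /serpentine size_rcons mkseqS flatten_rcons nth_rcons ltnn eqxx.
congr (flatten _ ++ _); apply/eq_in_map => i; rewrite mem_iota add0n => /= lt_i.
by rewrite nth_rcons lt_i.
Qed.

Lemma mem_serpentineP (xs : seq nat) (hs : nat -> seq nat) (p : int * int) :
  p \in serpentine xs hs <->
  exists i h : nat,
    [/\ (i < size xs)%N, h \in hs i & p = ((nth 0%N xs i)%:Z, h%:Z)].
Proof.
rewrite /serpentine; split=> [/flatten_mapP[i]|[i [h [lt_i h_i ->]]]].
  rewrite mem_iota add0n => /= lt_i pi.
  have /mapP[h h_i ->]: p \in [seq ((nth 0%N xs i)%:Z, h%:Z) | h <- hs i].
    by move: pi; case: odd; rewrite ?mem_rev.
  by exists i, h.
apply/flatten_mapP; exists i; first by rewrite mem_iota add0n.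
by case: odd; rewrite ?mem_rev; apply/mapP; exists h.
Qed.

Lemma serpentine_uniq (xs : seq nat) (hs : nat -> seq nat) :
  uniq xs -> (forall i, uniq (hs i)) -> uniq (serpentine xs hs).
Proof.
move=> + uniq_hs; elim/last_ind: xs => // xs x IHxs.
rewrite rcons_uniq serpentine_rcons cat_uniq => /andP[x_xs /IHxs ->] /=.
apply/andP; split; last first.
  by case: odd; rewrite ?rev_uniq map_inj_uniq // => i j [].
apply/hasPn => p p_x; apply/negP => /mem_serpentineP[i [h [lt_i _ eq_p]]].
have: exists h', p = (x%:Z, h').
  by move: p_x; case: odd; rewrite ?mem_rev => /mapP[h' _ ->]; exists h'%:Z.
case=> h'; rewrite eq_p => -[eq_x _].
by rewrite -eq_x mem_nth in x_xs.
Qed.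

Lemma size_serpentine_le (xs : seq nat) (hs : nat -> seq nat) (M : nat) :
  (forall i, (size (hs i) <= M)%N) -> (size (serpentine xs hs) <= size xs * M)%N.
Proof.
move=> size_hs; elim/last_ind: xs => // xs x IHxs.
rewrite serpentine_rcons size_cat size_rcons mulSn addnC leq_add //.
by case: odd; rewrite ?size_rev size_map.
Qed.

Lemma serpentine_subseq (xs : seq nat) (hs hs' : nat -> seq nat) :
  (forall i, subseq (hs i) (hs' i)) ->
  subseq (serpentine xs hs) (serpentine xs hs').
Proof.
move=> sub_hs; elim/last_ind: xs => // xs x IHxs.
rewrite !serpentine_rcons cat_subseq //.
by case: odd => /=; rewrite ?subseq_rev map_subseq.
Qed.

Lemma rev_ends (T : Type) (p : T) (s : seq T) :
  exists t, rev (p :: s) = last p s :: t /\ last (last p s) t = p.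
Proof.
case/lastP: s => [|s q]; first by exists [::].
by exists (rcons (rev s) p); rewrite rev_cons rev_rcons !last_rcons.
Qed.

Section SerpentineLength.
Context {R : realType}.

(** The prepended height 0 makes every traversal run the full height [m], and the horizontal
    connections telescope because [xs] is sorted. *)
Lemma len_serpentine (xs : seq nat) (hs : nat -> seq nat) (m : nat) :
    sorted leq xs ->
    (forall i, path leq 0%N (hs i)) -> (forall i, last 0%N (hs i) = m) ->
  len (map (emb R) (serpentine xs (fun i => 0%N :: hs i))) =
    ((size xs * m + (last 0%N xs - head 0%N xs))%N)%:R.
Proof.
move=> + sorted_hs last_hs.
pose col i x : seq (R * R) := [seq (x%:R, h) | h <- [seq h%:R | h <- 0%N :: hs i]].
have len_col i x : len (col i x) = m%:R.
  rewrite /col /= len_from_vertical ?last_map ?last_hs ?subr0 //.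
  rewrite (@path_map _ _ (fun h : nat => h%:R : R) <=%R 0%N).
  apply: sub_path (sorted_hs i) => a b /=.
  by rewrite ler_nat.
have emb_col i x : [seq emb R p | p <- [seq (x%:Z, h%:Z) | h <- 0%N :: hs i]] = col i x.
  by rewrite /col -!map_comp.
have last_col i x p : last p (col i x) = (x%:R, m%:R).
  by rewrite /col /= !last_map last_hs.
(* The induction must carry the endpoint too: its height alternates between [m] and 0, and the next
   traversal starts at that same height, so each connection is horizontal. *)
suff: sorted leq xs ->
  len (map (emb R) (serpentine xs (fun i => 0%N :: hs i))) =
    ((size xs * m + (last 0%N xs - head 0%N xs))%N)%:R /\
  (xs = [::] \/ exists p s, map (emb R) (serpentine xs (fun i => 0%N :: hs i)) = p :: s
   /\ last p s = ((last 0%N xs)%:R, (if odd (size xs) then m else 0%N)%:R)).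
  by move=> H /H[].
elim/last_ind: xs => [|xs x IHxs] sorted_xs; first by split; [|left].
have {IHxs}[IHlen IHlast] :=
  IHxs (subseq_sorted leq_trans (subseq_rcons xs x) sorted_xs).
pose c := if odd (size xs) then rev (col (size xs) x) else col (size xs) x.
have -> : [seq emb R i | i <- serpentine (rcons xs x) (fun i => 0%N :: hs i)] =
   [seq emb R i | i <- serpentine xs (fun i => 0%N :: hs i)] ++ c.
  by rewrite serpentine_rcons map_cat /c /= -emb_col; case: odd; rewrite ?map_rev.
have [q [t [Ec Eq Et]]] : exists q t,
  [/\ c = q :: t, q = (x%:R, (if odd (size xs) then m else 0%N)%:R)
   & last q t = (x%:R, (if odd (size xs) then 0%N else m)%:R)].
  have Ecol : col (size xs) x = (x%:R, 0) :: behead (col (size xs) x) by [].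
  have Elast := last_col (size xs) x (x%:R, 0); rewrite Ecol /= in Elast.
  rewrite /c Ecol; case: odd; last by exists (x%:R, 0), (behead (col (size xs) x)).
  have [t [-> Et]] := rev_ends (x%:R, 0) (behead (col (size xs) x)).
  by rewrite Elast in Et *; exists (x%:R, m%:R), t.
have len_c : len c = m%:R by rewrite /c; case: odd; rewrite ?len_rev len_col.
rewrite size_rcons last_rcons; split.
  case: IHlast => [xs0|[p [s [Ep Es]]]].
    by rewrite xs0 /= in len_c *; rewrite len_c subnn addn0 mul1n.
  have [y [ys Exs]] : exists y ys, xs = y :: ys by case: (xs) Ep => // y ys; exists y, ys.
  have: (head 0 xs <= last 0 xs <= x)%N /\ head 0%N (rcons xs x) = head 0%N xs.
    rewrite Exs rcons_cons /= in sorted_xs *; split => //.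
    rewrite rcons_path in sorted_xs.
    case/andP: sorted_xs => /(order_path_min leq_trans)/allP le_y ->.
    by rewrite andbT; have := mem_last y ys; rewrite inE => /predU1P[->|/le_y].
  case=> /andP[le_hl le_lx] ->.
  rewrite Ep Ec cat_cons len_cat -Ep IHlen -Ec len_c Es Eq.
  rewrite /l1 /= subrr normr0 addr0 ger0_norm; last first.
    by rewrite subr_ge0 ler_nat.
  rewrite -natrB // -!natrD; congr (_%:R).
  by rewrite mulSn; lia.
right; case: IHlast => [xs0|[p [s [Ep Es]]]].
  by rewrite xs0 in Ec Et *; exists q, t; rewrite Ec Et.
rewrite Ep Ec; exists p, (s ++ q :: t); split => //.
by rewrite last_cat /= Et; case: odd.
Qed.
End SerpentineLength.

(** * Up-and-down paths *)

(** Clamping [i * r] at [w] merges the regular abscissae and the possible extra last one into one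
    formula; [M] is w/r rounded up. *)
Lemma abscissaeE (w r : nat) : (0 < r)%N ->
  exists M : nat, [/\ abscissae w r = mkseq (fun i => minn (i * r) w) M.+1,
                      (w <= M * r)%N & (M * r < w + r)%N].
Proof.
move=> r_gt0; have le_w := leq_trunc_div w r.
have lt_w : (w < (w %/ r).+1 * r)%N by rewrite -ltn_divLR.
have E : [seq (i * r)%N | i <- iota 0 (w %/ r).+1] =
         mkseq (fun i => minn (i * r) w) (w %/ r).+1.
  apply/eq_in_map => i; rewrite mem_iota add0n => /andP[_ le_i].
  apply/esym/minn_idPl; apply: leq_trans le_w.
  by rewrite leq_mul2r -ltnS le_i orbT.
rewrite /abscissae E; case: ifPn => [r_w|r_nw].
  by exists (w %/ r)%N; rewrite cats0 divnK // -[X in (X < _)%N]addn0 ltn_add2l.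
exists (w %/ r).+1; split; last 2 first; [exact: ltnW| |].
  by rewrite mulSn addnC ltn_add2r ltn_neqAle le_w -dvdn_eq r_nw.
by rewrite [RHS]mkseqS cats1 (minn_idPr (ltnW lt_w)).
Qed.

Lemma mem_heights (m d s h : nat) :
  (h \in heights m d s) = ((h == s %[mod d])%N || (h == m)) && (h <= m)%N.
Proof. by rewrite mem_filter mem_iota add0n ltnS. Qed.

Lemma heights_uniq (m d s : nat) : uniq (heights m d s).
Proof. by rewrite filter_uniq ?iota_uniq. Qed.

(** The residue class contributes at most [m %/ d + 1] heights, and the top stop at most one
    more. *)
Lemma size_heights_le (m d s : nat) : (s < d)%N ->
  (size (heights m d s) * d <= m + 2 * d)%N.
Proof.
move=> lt_sd.
have le_size : (size (heights m d s) <= (m %/ d).+2)%N.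
  have -> : (m %/ d).+2 = size (m :: mkseq (fun j => j * d + s)%N (m %/ d).+1).
    exact: (congr1 succn (esym (size_mkseq _ _))).
  apply: uniq_leq_size (heights_uniq m d s) _ => h; rewrite mem_heights inE.
  case/andP=> /orP[/eqP h_s|-> //] le_hm; apply/orP; right; apply/mapP.
  exists (h %/ d)%N; first by rewrite mem_iota add0n ltnS leq_div2r.
  by rewrite [LHS](divn_eq h d) h_s (modn_small lt_sd).
rewrite (leq_trans (leq_mul le_size (leqnn d))) // -[(m %/ d).+2]addn2 mulnDl.
by rewrite leq_add2r leq_trunc_div.
Qed.

Lemma path_heights (m d s : nat) : path leq 0 (heights m d s).
Proof.
rewrite (path_sortedE leq_trans) sorted_filter ?iota_sorted ?andbT //.
  by apply/allP.
exact: leq_trans.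
Qed.

Lemma last_heights (m d s : nat) : last 0%N (heights m d s) = m.
Proof.
by rewrite /heights -addn1 iotaD filter_cat /= eqxx orbT add0n last_cat.
Qed.

(** A discrete intermediate value argument, used to find the grid cell that contains a given
    point. *)
Lemma nat_grid_bracket (R : realType) (f : nat -> nat) (M : nat) (x : R) :
  (f 0%N)%:R <= x <= (f M.+1)%:R ->
  exists i, (i <= M)%N /\ (f i)%:R <= x <= (f i.+1)%:R.
Proof.
elim: M => [|M IHM] /andP[le_0x le_xM]; first by exists 0%N; rewrite le_0x.
have [le_x|lt_x] := leP x (f M.+1)%:R; last first.
  by exists M.+1; rewrite ltW.
have [|i [le_i Hi]] := IHM; first by rewrite le_0x.
by exists i; rewrite leqW.
Qed.

Section UpDown.
Variables (R : realType) (k n m e : nat).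
Hypotheses (e_gt0 : (0 < e)%N) (le_ek : (e <= k)%N) (n_gt0 : (0 < n)%N).
Let d := (2 * e)%N.
Let r := (2 * k - e)%N.

Let half_d : d./2 = e.
Proof. by rewrite /d mul2n doubleK. Qed.

Let spacingE : spacing k d = r.
Proof. by rewrite /spacing half_d. Qed.

Let xs_shift0 : [seq (0 + x)%N | x <- abscissae n r] = abscissae n r.
Proof. exact: map_id. Qed.

Let shift i := if odd i then d./2 else 0%N.

Let shift_lt i : (shift i < d)%N.
Proof. by rewrite /shift half_d /d; case: odd; lia. Qed.

(** Modulo [2 * e], the multiple [i * e] is 0 or [e] according to the parity of [i]; if it is
    clamped, it becomes [m], a stop of every traversal. *)
Let bracket_heights (i : nat) : minn (i * e) m \in heights m d (shift i).
Proof.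
rewrite mem_heights geq_minr andbT /shift half_d /d /minn.
case: ltnP => _; last by rewrite eqxx orbT.
apply/orP; left; rewrite -[X in (X * e)%N]odd_double_half mulnDl.
have -> : (i./2.*2 * e = i./2 * (2 * e))%N by lia.
by rewrite addnC modnMDl; case: odd; rewrite ?mul1n ?mul0n.
Qed.

(** The abscissae and the clamped multiples of [e] cut D into cells. The grid points whose two
    indices have equal parity are stops, as on a chequerboard, so every cell has stops at two
    opposite corners. *)
Lemma up_down_covering : covering_path k n m (up_down R k n m d).
Proof.
have r_gt0 : (0 < r)%N by rewrite /r; lia.
have [M [xsE le_nM lt_Mn]] := abscissaeE n r_gt0.
have M_gt0 : (0 < M)%N by case: (M) le_nM; lia.
rewrite /up_down /up_down_stops /up_down_route spacingE xs_shift0; split.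
- apply: serpentine_uniq => [|i]; last exact: heights_uniq.
  rewrite xsE; apply/mkseq_uniqP => i j; rewrite !inE !ltnS.
  wlog lt_ij : i j / (i < j)%N.
    by move=> IH le_iM le_jM; case: (ltngtP i j) => // /IH H E; first exact: H; apply/esym/H.
  move=> le_iM le_jM; suff: (minn (i * r) n < minn (j * r) n)%N by lia.
  (* With [M * r < n + r] this gives [i * r < n]: the smaller index is not clamped, so the abscissae
     are distinct. *)
  have : (i.+1 * r <= j * r)%N by rewrite leq_mul2r lt_ij orbT.
  have : (i.+1 * r <= M * r)%N by rewrite leq_mul2r (leq_trans lt_ij) ?orbT.
  by rewrite mulSn; lia.
- rewrite /=; apply/allP => p /mem_serpentineP[i [h [lt_i h_i ->]]].
  rewrite /in_Dint /= !lez_nat mem_heights in h_i *.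
  case/andP: h_i => _ ->; rewrite andbT.
  by move: lt_i; rewrite xsE size_mkseq => lt_i; rewrite nth_mkseq // geq_minr.
- rewrite /=; case=> x y /andP[/= /andP[x_ge0 x_le] /andP[y_ge0 y_le]].
  have [|a [le_a /andP[le_ax le_xa]]] :=
      @nat_grid_bracket R (fun i => minn (i * r) n) M.-1 x.
    by rewrite prednK // mul0n min0n (minn_idPr le_nM) x_ge0.
  have [|b [le_b /andP[le_by le_yb]]] :=
      @nat_grid_bracket R (fun i => minn (i * e) m) m y.
    rewrite mul0n min0n y_ge0 (minn_idPr _) //.
    by rewrite mulSn (leq_trans (leq_pmulr m e_gt0)) ?leq_addl.
  have stop c i : (c <= M)%N -> odd c = odd i ->
      ((minn (c * r) n)%:Z, (minn (i * e) m)%:Z) \in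
        serpentine (abscissae n r) (fun i => heights m d (shift i)).
    move=> le_cM odd_ci; apply/mem_serpentineP; exists c, (minn (i * e) m).
    rewrite xsE size_mkseq nth_mkseq //; split => //.
    by have := bracket_heights i; rewrite /shift odd_ci.
  have gap_x : (minn (a.+1 * r) n)%:R - (minn (a * r) n)%:R <= r%:R :> R.
    by rewrite lerBlDr -natrD ler_nat mulSn; lia.
  have gap_y : (minn (b.+1 * e) m)%:R - (minn (b * e) m)%:R <= e%:R :> R.
    by rewrite lerBlDr -natrD ler_nat mulSn; lia.
  have gap_sum : r%:R + e%:R = 2 * k%:R :> R.
    by rewrite -natrD -natrM; congr (_%:R); rewrite /r; lia.
  have le_aM : (a.+1 <= M)%N by rewrite -(prednK M_gt0).
  (* Both candidate stops lie on opposite corners of a grid cell of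
     semiperimeter at most 2k, so one of them is within distance k. *)
  have opposite (y1 y2 : R) :
      [\/ y1 <= y <= y2 /\ y2 - y1 <= e%:R | y2 <= y <= y1 /\ y1 - y2 <= e%:R] ->
      l1 (x, y) ((minn (a * r) n)%:R, y1) <= k%:R \/
      l1 (x, y) ((minn (a.+1 * r) n)%:R, y2) <= k%:R.
    move=> Hy; rewrite /l1 /= (ger0_norm (_ : 0 <= x - _)) ?subr_ge0 //.
    rewrite (distrC x) (ger0_norm (_ : 0 <= _ - x)) ?subr_ge0 //.
    case: Hy => -[/andP[y_1 y_2] Hg].
    + rewrite ger0_norm ?subr_ge0 // distrC ger0_norm ?subr_ge0 //.
      by case: (leP (x - (minn (a * r) n)%:R + (y - y1)) k%:R) => H; [left|right; lra].
    + rewrite distrC ger0_norm ?subr_ge0 // ger0_norm ?subr_ge0 //.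
      by case: (leP (x - (minn (a * r) n)%:R + (y1 - y)) k%:R) => H; [left|right; lra].
  (* Equal parities put the stops at the lower left and upper right corners, unequal ones at the
     upper left and lower right. *)
  case: (boolP (odd a == odd b)) => [/eqP odd_ab|odd_ab].
  + case: (opposite (minn (b * e) m)%:R (minn (b.+1 * e) m)%:R) => [|H|H].
    * by left; rewrite le_by.
    * by eexists; [apply: (stop a b) => //; exact: ltnW|].
    * by eexists; [apply: (stop a.+1 b.+1) => //=; rewrite odd_ab|].
  + have {}odd_ab : odd a = ~~ odd b by move: odd_ab; case: odd; case: odd.
    case: (opposite (minn (b.+1 * e) m)%:R (minn (b * e) m)%:R) => [|H|H].
    * by right; rewrite le_by.
    * by eexists; [apply: (stop a b.+1) => //; exact: ltnW|].
    * by eexists; [apply: (stop a.+1 b) => //=; rewrite odd_ab negbK|].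
- by apply: map_subseq; apply: serpentine_subseq => i; exact: subseq_cons.
Qed.

(** [N] is the number of traversals and [H] bounds the stops on each. Bounding products avoids
    division. *)
Lemma up_down_length_count : exists N H : nat,
  [/\ (N * r <= n + 2 * r)%N, (H * d <= m + 2 * d)%N,
      path_length (up_down R k n m d) = (N * m + n)%:R
    & (stop_count (up_down R k n m d) <= N * H)%N].
Proof.
have r_gt0 : (0 < r)%N by rewrite /r; lia.
have [M [xsE le_nM lt_Mn]] := abscissaeE n r_gt0.
pose H := ((m + 2 * d) %/ d)%N.
have d_gt0 : (0 < d)%N by rewrite /d; lia.
exists M.+1, H; split.
- by rewrite mulSn mul2n -addnn; lia.
- exact: leq_trunc_div.
- rewrite path_lengthE /up_down /up_down_route spacingE xs_shift0 (@len_serpentine _ _ _ m).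
  + rewrite xsE size_mkseq -nth0 -nth_last size_mkseq !nth_mkseq //=.
    by rewrite mul0n min0n subn0 (minn_idPr le_nM).
  + rewrite xsE; apply/(sortedP 0%N) => i; rewrite size_mkseq => lt_i.
    by rewrite !nth_mkseq //; [rewrite mulSn; lia|exact: ltnW].
  + by move=> i; exact: path_heights.
  + by move=> i; exact: last_heights.
- rewrite /stop_count /up_down /up_down_stops spacingE xs_shift0.
  rewrite (leq_trans (@size_serpentine_le _ _ H _)) ?xsE ?size_mkseq // => i.
  by rewrite leq_divRL // size_heights_le // shift_lt.
Qed.
End UpDown.

(** * Lower bound *)

(** Edges along the top and right sides of D are left out, so that there are exactly 2nm. *)
Definition edge (n m : nat) : finType := ('I_n * 'I_m * bool)%type.

(* [(x, y, b)] stands for the edge from [(x, y)] to [(x, y + 1)] if [b] and to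
   [(x + 1, y)] otherwise. *)
Definition midpoint (R : realType) (n m : nat) (t : edge n m) : R * R :=
  let: (x, y, b) := t in (x%:R + (~~ b)%:R / 2, y%:R + b%:R / 2).

(* Floors of the sum and of the difference of the coordinates of the midpoint. *)
Definition edge_sum (n m : nat) (t : edge n m) : int :=
  let: (x, y, _) := t in x%:Z + y%:Z.

Definition edge_diff (n m : nat) (t : edge n m) : int :=
  let: (x, y, b) := t in x%:Z - y%:Z - b%:Z.

(** In sum and difference coordinates the ball is a square of side 2k. Midpoints have half-integer
    coordinates there, so each closed interval of length 2k becomes a half-open range of 2k
    floors. *)
Definition covered (n m k : nat) (q : int * int) : {set edge n m} :=
  [set t | [&& q.1 + q.2 - k%:Z <= edge_sum t, edge_sum t < q.1 + q.2 + k%:Z,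
               q.1 - q.2 - k%:Z <= edge_diff t & edge_diff t < q.1 - q.2 + k%:Z]].

Definition dist1 (p q : int * int) : nat := (`|p.1 - q.1| + `|p.2 - q.2|)%N.

Definition gain (k s : nat) : nat := ((2 * k) ^ 2 - (2 * k - s) ^ 2)%N.

Lemma l1_emb (R : realType) (p q : int * int) :
  l1 (emb R p) (emb R q) = (dist1 p q)%:R.
Proof. by rewrite /l1 /= -!intrB natrD !natr_absz -!intr_norm. Qed.

Lemma covered_near (R : realType) (n m k : nat) (t : edge n m) (q : int * int) :
  l1 (midpoint R t) (emb R q) <= k%:R -> t \in covered n m k q.
Proof.
case: t q => [[x y] b] [a c]; rewrite inE /l1 /= => le_k.
set X := _ + _ - _ in le_k; set Y := _ + _ / _ - _ in le_k.
have leX := ler_norm X; have leNX := ler_norm (- X).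
have leY := ler_norm Y; have leNY := ler_norm (- Y).
rewrite !normrN in leNX leNY.
have EX : X = (x%:Z)%:~R + (~~ b)%:R / 2 - a%:~R by [].
have EY : Y = (y%:Z)%:~R + b%:R / 2 - c%:~R by [].
have Ek : k%:R = (k%:Z)%:~R :> R by [].
have Eb : (~~ b)%:R = 1 - b%:R :> R by case: (b); rewrite ?subrr ?subr0.
have Ebz : (b%:Z)%:~R = b%:R :> R by [].
apply/and4P; split.
- by rewrite -ltzD1 -(ltr_int R) !(intrD, intrB) //; lra.
- by rewrite -(ltr_int R) !(intrD, intrB); lra.
- by rewrite -ltzD1 -(ltr_int R) !(intrD, intrB); lra.
- by rewrite -(ltr_int R) !(intrD, intrB); lra.
Qed.

(** The set is the overlap of an integer interval with a translate; ['I_(K - |z|)] injects into it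
    after a shift by [o]. *)
Lemma card_shifted_interval (K : nat) (z : int) :
  (K - `|z| <= #|[set i : 'I_K | (0 <= i%:Z + z < K%:Z)%R]|)%N.
Proof.
case: K => // K; pose o := if 0 <= z then 0%N else `|z|%N.
have Ho (j : 'I_(K.+1 - `|z|)) : (j + o < K.+1)%N.
  by rewrite /o; case: j => j /=; case: ifP; lia.
pose f j := Ordinal (Ho j).
have f_inj : injective f by move=> i j [] /addIn /val_inj.
rewrite -[leqLHS]card_ord -(card_codom f_inj); apply/subset_leq_card/subsetP => i.
case/codomP=> -[j lt_j] ->; rewrite inE /= /o.
by case: ifP; lia.
Qed.

(** Relative to the square of [q], the square of [p] is displaced by [du] and [dv], so their overlap
    is a product of two interval overlaps. *)
Lemma card_covered_setD (n m k : nat) (p q : int * int) :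
  (#|covered n m k q :\: covered n m k p| <= gain k (dist1 q p))%N.
Proof.
case: k => [|k'].
  rewrite (_ : covered n m 0 q = set0) ?set0D ?cards0 //.
  by apply/setP => t; rewrite !inE; lia.
set k := k'.+1; pose K := (2 * k).-1.
pose du := q.1 + q.2 - (p.1 + p.2); pose dv := q.1 - q.2 - (p.1 - p.2).
pose A (z : int) := [set i : 'I_K.+1 | 0 <= i%:Z + z < (K.+1)%:Z].
pose f (t : edge n m) : 'I_K.+1 * 'I_K.+1 :=
  (inord (absz (edge_sum t - (q.1 + q.2 - k%:Z))%R),
     inord (absz (edge_diff t - (q.1 - q.2 - k%:Z))%R)).
have fE t : t \in covered n m k q ->
    (f t).1%:Z = edge_sum t - (q.1 + q.2 - k%:Z) /\
    (f t).2%:Z = edge_diff t - (q.1 - q.2 - k%:Z).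
  rewrite inE => /and4P[h1 h2 h3 h4].
  by rewrite /f /= !inordK /K; lia.
have f_inj : {in covered n m k q :\: covered n m k p &, injective f}.
  move=> t t' /setDP[/fE[E1 E2] _] /setDP[/fE[E1' E2'] _] Ef.
  rewrite Ef in E1 E2.
  have {E1 E1'} : edge_sum t = edge_sum t' by lia.
  have {E2 E2'} : edge_diff t = edge_diff t' by lia.
  (* The sum of [edge_sum] and [edge_diff] is 2x - b, whose parity reveals [b]. *)
  case: t {Ef} => [[x y] b]; case: t' => [[x' y'] b']; rewrite /edge_sum /edge_diff => E2 E1.
  have Ex : x = x' by apply: val_inj => /=; lia.
  have Ey : y = y' by apply: val_inj => /=; lia.
  have Eb : b = b' by lia.
  by rewrite Ex Ey Eb.
rewrite -(card_in_imset f_inj).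
(* The overlap is removed from the full index grid, so squares that stick out of D need no separate
   treatment. *)
have sub : f @: (covered n m k q :\: covered n m k p) \subset ~: setX (A du) (A dv).
  apply/subsetP => _ /imsetP[t /setDP[tq tp] ->].
  have [E1 E2] := fE _ tq; move: tp; rewrite !inE E1 E2 /K /du /dv /=.
  by apply: contra; lia.
rewrite (leq_trans (subset_leq_card sub)) //.
have := cardsC (setX (A du) (A dv)); rewrite card_prod !card_ord cardsX => cardE.
have := leq_mul (card_shifted_interval K.+1 du) (card_shifted_interval K.+1 dv).
rewrite -/(A du) -/(A dv) => le_A.
(* Both [|du|] and [|dv|] are at most the distance of the two stops. *)
have le_sq : ((2 * k - dist1 q p) ^ 2 <= (K.+1 - `|du|) * (K.+1 - `|dv|))%N.
  by rewrite -mulnn leq_mul // /K /dist1 /du /dv; lia.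
have EK : (2 * k)%N = K.+1 by rewrite /K; lia.
by rewrite /gain EK -mulnn in le_sq *; lia.
Qed.

(** The square of a stop displaced by 2k is disjoint from that of [q], so every midpoint of [q]
    counts as new. *)
Lemma card_covered (n m k : nat) (q : int * int) :
  (#|covered n m k q| <= (2 * k) ^ 2)%N.
Proof.
pose p := (q.1 + (2 * k)%:Z, q.2).
have disj : [disjoint covered n m k q & covered n m k p].
  by rewrite disjoint_subset; apply/subsetP => t; rewrite !inE /=; lia.
rewrite -(setDidPl disj) (leq_trans (card_covered_setD _ _ _ _ _)) //.
exact: leq_subr.
Qed.

Lemma covering_lower_bound (R : realType) (k n m : nat) (alpha beta c : R)
    (P : stop_path R) :
    (0 < n)%N -> (0 < m)%N -> 0 <= alpha -> 0 <= beta ->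
    (forall s : nat, (0 < s)%N -> c * (gain k s)%:R <= alpha * s%:R + beta) ->
    0 <= c ->
    covering_path k n m P ->
  c * (2 * (n%:R * m%:R) - 4 * k%:R ^+ 2) <= cost alpha beta P.
Proof.
move=> n_gt0 m_gt0 alpha_ge0 beta_ge0 c_gain c_ge0 [uniqP _ covP subP].
rewrite /cost path_lengthE /stop_count.
have le_len := len_subseq subP.
suff: c * (2 * (n%:R * m%:R) - 4 * k%:R ^+ 2) <=
    alpha * len (map (emb R) (stops P)) + beta * (size (stops P))%:R.
  by move=> /le_trans-> //; rewrite lerD2r ler_wpM2l.
pose cov (s : seq (int * int)) := [set t | has (fun q => t \in covered n m k q) s].
have all_cov : cov (stops P) = setT.
  apply/setP => t; rewrite !inE; apply/hasP.
  have [|q qP near_q] := covP (midpoint R t).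
    case: t => [[x y] b]; rewrite /in_D /=.
    have := ler_nat R x.+1 n; rewrite ltn_ord -natr1 => Hx.
    have := ler_nat R y.+1 m; rewrite ltn_ord -natr1 => Hy.
    have x_ge0 : 0 <= x%:R :> R by [].
    have y_ge0 : 0 <= y%:R :> R by [].
    by case: b; rewrite /= ?mul0r ?mul1r ?addr0; apply/andP; split; apply/andP; split; lra.
  by exists q => //; apply: covered_near near_q.
have card_all : #|cov (stops P)|%:R = 2 * (n%:R * m%:R) :> R.
  by rewrite all_cov cardsT !card_prod !card_ord card_bool mulnC !natrM.
rewrite -card_all; clear le_len subP covP all_cov card_all.
(* Stops are added from the last to the first. Only hops are charged, hence [size s]; the term 4k^2
   pays for the midpoints of the last stop. *)
have step q s : uniq (q :: s) -> c * (#|cov (q :: s)|%:R - 4 * k%:R ^+ 2) <=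
    alpha * len (map (emb R) (q :: s)) + beta * (size s)%:R.
  elim: s q => [|q' s IHs] q.
    move=> _; rewrite /= !mulr0 addr0 mulr_ge0_le0 // subr_le0 /cov.
    have -> : [set t | has (fun q => t \in covered n m k q) [:: q]] = covered n m k q.
      by apply/setP => t; rewrite [in LHS]inE /= orbF.
    rewrite (_ : 4 * _ = ((2 * k) ^ 2)%:R) ?ler_nat ?card_covered //.
    by rewrite natrX natrM; ring.
  move=> /= /andP[q_s /IHs {}IHs].
  (* Stops are distinct, so each hop has positive length, as [c_gain] requires. *)
  have neq_q : (0 < dist1 q' q)%N.
    rewrite /dist1 lt0n addn_eq0 !absz_eq0 !subr_eq0; apply: contra q_s.
    case: q q' {IHs} => a b [a' b'] /= /andP[/eqP-> /eqP->].
    exact: mem_head.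
  have : (#|cov (q :: q' :: s)| <= #|cov (q' :: s)| + gain k (dist1 q' q))%N.
    have -> : cov [:: q, q' & s] =
        cov (q' :: s) :|: (covered n m k q :\: covered n m k q').
      apply/setP => t; rewrite [in LHS]inE in_setU in_setD [in RHS]inE /=.
      by case: (t \in _); case: (t \in _); case: has.
    rewrite (leq_trans (leq_card_setU _ _)) // leq_add2l.
    have -> : dist1 q' q = dist1 q q' by rewrite /dist1; lia.
    exact: card_covered_setD.
  rewrite -(ler_nat R) natrD => /(ler_wpM2l c_ge0).
  have := c_gain _ neq_q; rewrite -(l1_emb R); move: IHs => /=.
  rewrite -[(size s).+1%:R]natr1; set L := len_from _ _; set l := l1 _ _.
  move=> H1 H2 H3. lra.
case: (stops P) uniqP => [_|q s uniqP].
  rewrite (_ : cov [::] = set0) ?cards0 /=; last by apply/setP => t; rewrite !inE.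
  rewrite !mulr0 addr0 sub0r mulrN oppr_le0.
  by rewrite mulr_ge0 // mulr_ge0 // exprn_ge0.
apply: le_trans (step q s uniqP) _.
by rewrite lerD2l ler_wpM2l // ler_nat leqnSn.
Qed.

(** * The best even period *)

Lemma gainE (R : realType) (k s : nat) : (s <= 2 * k)%N ->
  (gain k s)%:R = s%:R * (4 * k%:R - s%:R) :> R.
Proof.
move=> le_s; rewrite /gain natrB ?leq_sqr ?leq_subr //.
by rewrite !natrX natrB // natrM; ring.
Qed.

Lemma gain_saturated (k s : nat) : (2 * k <= s)%N -> gain k s = gain k (2 * k).
Proof. by move=> le_s; rewrite /gain subnn (eqP le_s). Qed.

Lemma approx_ratioD (R : realType) (k : nat) (eps : R) :
  approx_ratio k eps = approx_ratio k 0 + eps.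
Proof. by rewrite /approx_ratio; case: ifP => _; [|case: ifP => _]; rewrite addr0. Qed.

Lemma approx_ratio_bounds (R : realType) (k : nat) :
  9 / 8 <= approx_ratio k (0 : R) <= 3 / 2.
Proof.
by rewrite /approx_ratio; case: ifP => _; [|case: ifP => _]; apply/andP; split; lra.
Qed.

(** [gain k 1] is 4k - 1 and half of [gain k 2] is 4k - 2. Their quotient is 3/2 for k = 1, 7/6 for
    k = 2 and at most 11/10 beyond. *)
Lemma approx_ratio_unit_step (R : realType) (k : nat) : (0 < k)%N ->
  4 * k%:R - 1 <= approx_ratio k 0 * (4 * k%:R - 2) :> R.
Proof.
rewrite /approx_ratio; case: k => [|[|[|k]]] //= _; try lra.
have : 0 <= k%:R :> R by [].
by rewrite -[k.+3]addn3 natrD; lra.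
Qed.

(** The value [v] is the least price per newly covered midpoint among the even periods [2 * e]. *)
Lemma exists_good_period (R : realType) (k : nat) (alpha beta : R) :
    (0 < k)%N -> 0 <= alpha -> 0 <= beta ->
  exists (e : nat) (v : R),
    [/\ (0 < e <= k)%N, 0 <= v,
        v * (gain k (2 * e))%:R = alpha * (2 * e)%:R + beta
      & forall s : nat, (0 < s)%N ->
          v * (gain k s)%:R <= approx_ratio k 0 * (alpha * s%:R + beta)].
Proof.
move=> k_gt0 alpha_ge0 beta_ge0.
have gain_gt0 e : (0 < e <= k)%N -> 0 < (gain k (2 * e))%:R :> R.
  case/andP=> e_gt0 le_ek; rewrite gainE ?leq_mul2l // natrM.
  have : 1 <= e%:R :> R by rewrite ler1n.
  have : e%:R <= k%:R :> R by rewrite ler_nat.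
  by move=> H1 H2; apply: mulr_gt0; lra.
pose price e : R := (alpha * (2 * e)%:R + beta) / (gain k (2 * e))%:R.
case: (@arg_minP _ _ _ (Ordinal k_gt0) predT (fun i => price i.+1)) => // i _ min_i.
exists i.+1, (price i.+1).
have cost_ge0 s : 0 <= alpha * s%:R + beta by rewrite addr_ge0 ?mulr_ge0.
have v_ge0 : 0 <= price i.+1 by rewrite divr_ge0.
split; rewrite ?ltn_ord //.
  by rewrite divfK // gt_eqF // gain_gt0 //= ltn_ord.
have {min_i} even_step e : (0 < e <= k)%N ->
    price i.+1 * (gain k (2 * e))%:R <= alpha * (2 * e)%:R + beta.
  case: e => // e le_ek; rewrite -ler_pdivlMr ?gain_gt0 //.
  exact: (min_i (Ordinal le_ek)).
move: (price _) v_ge0 even_step => v v_ge0 even_step s s_gt0.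
have /andP[rho_ge rho_le] := approx_ratio_bounds R k.
have ratio_ge1 t : alpha * t%:R + beta <= approx_ratio k 0 * (alpha * t%:R + beta).
  by rewrite ler_peMl //; lra.
have [le_2k|lt_2k] := leqP (2 * k) s.
  (* A step of length at least 2k gains no more than one of length 2k and costs at least as much. *)
  rewrite gain_saturated //; apply: le_trans (even_step k _) (le_trans _ (ratio_ge1 s)).
    by rewrite k_gt0 /=.
  by rewrite lerD2r ler_wpM2l // ler_nat.
case: (boolP (odd s)) => odd_s; last first.
  have Es : s = (2 * s./2)%N by rewrite mul2n even_halfK.
  rewrite Es; apply: le_trans (even_step _ _) (ratio_ge1 _).
  by lia.
have [s_eq1|s_gt1] := eqVneq s 1%N.
  have := even_step 1%N k_gt0; have := approx_ratio_unit_step R k_gt0.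
  rewrite s_eq1 !gainE ?muln1 //; try lia.
  set S := alpha * 1 + beta; set rho := approx_ratio k 0 => le_rho le_v.
  (* A step of length 2 costs at most twice a unit step, since beta is nonnegative. *)
  have {}le_v : v * (4 * k%:R - 2) <= S by rewrite /S; lra.
  have := ler_wpM2l v_ge0 le_rho.
  have rho_ge0 : 0 <= rho by by apply: le_trans rho_ge; lra.
  by have := ler_wpM2l rho_ge0 le_v; lra.
pose e := s./2.
have Es : s = (2 * e).+1 by rewrite -[LHS]odd_double_half odd_s mul2n.
have bound : (0 < e)%N /\ (e < k)%N by lia.
case: bound => e_gt0 lt_ek.
have H1 := even_step e; have H2 := even_step e.+1.
rewrite e_gt0 (ltnW lt_ek) in H1; rewrite lt_ek in H2.
move: {H1 H2}(H1 isT) (H2 isT); rewrite Es !gainE; try lia.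
have -> : (2 * e.+1)%:R = 2 * e%:R + 2 :> R by rewrite mulnSr natrD natrM.
have Es_R : ((2 * e).+1)%:R = 2 * e%:R + 1 :> R by rewrite -addn1 natrD natrM.
rewrite Es_R natrM; move: (ler_nat R 1 e) (ler_nat R e.+1 k).
rewrite e_gt0 lt_ek -[e.+1]addn1 natrD.
set x := e%:R; set K := k%:R => x_ge1 le_xK H1 H2.
set S := alpha * _ + _; set G := _ * (_ - _).
(* The threshold 9 is where G = 9/8 (G - 1). *)
have G_ge9 : 9 <= G.
  have : 0 <= (x - 1) * (K - x - 1) by apply: mulr_ge0; lra.
  have : 0 <= (x - 1) * (x - 1) by apply: mulr_ge0; lra.
  by rewrite /G; nra.
(* Averaging over s - 1 and s + 1 leaves the affine cost unchanged and lowers the quadratic gain by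
   exactly 1. *)
have le_G : v * (G - 1) <= S by rewrite /G /S; lra.
have le_vG : v * G <= 9 / 8 * S.
  by have := mulr_ge0 v_ge0 (_ : 0 <= G - 9); lra.
apply: le_trans le_vG _; apply: ler_wpM2r => //.
by have := cost_ge0 s; rewrite Es Es_R.
Qed.

(** * Cost of the best type-d path against the lower bound *)

(** With r = 2k - e, the gain equals 4er and cancels the divisions by r and d. The rounding terms
    add up to at most 24 k^2 m, which is below 3/10 eps n m because 100 k^2 <= eps n. *)
Lemma up_down_cost_le (R : realType) (k n m e : nat) (alpha beta eps : R) :
    (0 < e <= k)%N -> (0 < n <= m)%N -> 0 <= alpha -> 0 <= beta ->
    100 * k%:R ^+ 2 <= eps * n%:R ->
  (gain k (2 * e))%:R * cost alpha beta (up_down R k n m (2 * e)) <=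
    2 * (alpha * (2 * e)%:R + beta) * (n%:R * m%:R * (1 + 3 / 10 * eps)).
Proof.
case/andP=> e_gt0 le_ek /andP[n_gt0 le_nm] alpha_ge0 beta_ge0 large.
have [N [H [le_N le_H len_eq le_T]]] := @up_down_length_count R k n m e e_gt0 le_ek n_gt0.
rewrite /cost len_eq gainE ?leq_mul2l // natrD natrM.
have Er : (2 * k - e)%:R = 2 * k%:R - e%:R :> R.
  by rewrite natrB ?natrM //; lia.
have Ed : (2 * e)%:R = 2 * e%:R :> R by rewrite natrM.
move: le_N le_H le_T; rewrite -!(ler_nat R) !(natrD, natrM) Er.
have e_ge1 : 1 <= e%:R :> R by rewrite ler1n.
have n_ge1 : 1 <= n%:R :> R by rewrite ler1n.
have le_ekR : e%:R <= k%:R :> R by rewrite ler_nat.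
have le_nmR : n%:R <= m%:R :> R by rewrite ler_nat.
have N_ge0 : 0 <= N%:R :> R by [].
have H_ge0 : 0 <= H%:R :> R by [].
set T := (stop_count _)%:R.
move: (k%:R) (n%:R) (m%:R) (e%:R) (N%:R) (H%:R) T
  large e_ge1 n_ge1 le_ekR le_nmR N_ge0 H_ge0 {Er Ed len_eq}.
move=> K x y E NN HH T large e_ge1 n_ge1 le_ekR le_nmR N_ge0 H_ge0.
set r := 2 * K - E => le_N le_H le_T.
have r_ge : 1 <= r by rewrite /r; lra.
have r_le : r <= 2 * K by rewrite /r; lra.
have y_ge0 : 0 <= y by lra.
have large_y : 100 * (K ^+ 2 * y) <= eps * x * y.
  by rewrite mulrA ler_wpM2r.
have K_sqr : K <= K ^+ 2 by rewrite expr2; nra.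
have Ky : K * y <= K ^+ 2 * y by rewrite ler_wpM2r.
have Kx : K * x <= K * y by rewrite ler_wpM2l //; lra.
have KKy : K ^+ 2 <= K ^+ 2 * y by rewrite ler_peMr ?sqr_ge0 //; lra.
have ry : r * y <= 2 * K * y by rewrite ler_wpM2r.
have rx : r * x <= 2 * K * x by rewrite ler_wpM2r //; lra.
have Ex : E * x <= K * x by rewrite ler_wpM2r //; lra.
have rE : r * E <= 2 * K * K by apply: ler_pM; lra.
have le_len : r * (NN * y + x) <= x * y * (1 + 3 / 10 * eps).
  have : NN * r * y <= (x + 2 * r) * y by rewrite ler_wpM2r.
  by move: rE; nra.
have le_stops : r * (2 * E) * T <= x * y * (1 + 3 / 10 * eps).
  have rE_ge0 : 0 <= r * (2 * E) by apply: mulr_ge0; lra.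
  apply: (le_trans (ler_wpM2l rE_ge0 le_T)).
  have -> : r * (2 * E) * (NN * HH) = (NN * r) * (HH * (2 * E)) by ring.
  have : (NN * r) * (HH * (2 * E)) <= (x + 2 * r) * (y + 2 * (2 * E)).
    by apply: ler_pM => //; apply: mulr_ge0; lra.
  by move: rE; rewrite expr2 in large_y Ky KKy *; lra.
have EE_ge0 : 0 <= 2 * (2 * E) * alpha by apply: mulr_ge0; lra.
have := ler_wpM2l EE_ge0 le_len; have := ler_wpM2l beta_ge0 le_stops.
have -> : 4 * K - 2 * E = 2 * r by rewrite /r; ring.
lra.
Qed.

Theorem theorem6 (R : realType) (k n m : nat) (eps alpha beta : R)
    (hk : (1 <= k)%N) (hn : (1 <= n)%N) (hnm : (n <= m)%N)
    (heps : 0 < eps < 1) (halpha : 0 <= alpha) (hbeta : 0 <= beta)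
    (hlarge : 100 * k%:R ^+ 2 / eps <= n%:R) :
  exists P : stop_path R,
    [/\ is_mixed_up_down k n m P,
        covering_path k n m P
      & forall Q : stop_path R, covering_path k n m Q ->
          cost alpha beta P <= approx_ratio k eps * cost alpha beta Q].
Proof.
have := exists_good_period hk halpha hbeta.
case=> e [v [e_bnd v_ge0 v_eq v_gain]].
have /andP[e_gt0 le_ek] := e_bnd.
have /andP[eps_gt0 eps_lt1] := heps.
have large : 100 * k%:R ^+ 2 <= eps * n%:R by rewrite -ler_pdivrMl // mulrC.
exists (up_down R k n m (2 * e)); split.
- left; exists (2 * e)%N; split => //; first by rewrite oddM.
  by apply/andP; split; lia.
- exact: up_down_covering.
move=> Q covQ; have m_gt0 := leq_trans hn hnm.
have /andP[rho_ge rho_le] := approx_ratio_bounds R k.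
rewrite approx_ratioD; set rho := approx_ratio k 0 in v_gain rho_ge rho_le *.
have rho_gt0 : 0 < rho by lra.
have gain_gt0 : 0 < (gain k (2 * e))%:R :> R.
  by rewrite ltr0n /gain subn_gt0 ltn_sqr; lia.
have le_P : cost alpha beta (up_down R k n m (2 * e)) <=
    2 * v * (n%:R * m%:R * (1 + 3 / 10 * eps)).
  rewrite -(ler_pM2l gain_gt0).
  have := @up_down_cost_le R k n m e alpha beta eps; rewrite e_gt0 le_ek hn hnm -v_eq.
  by move=> /(_ isT isT halpha hbeta large); lra.
have le_Q : v * (2 * (n%:R * m%:R) - 4 * k%:R ^+ 2) <= rho * cost alpha beta Q.
  (* The lower bound is applied with c = v / rho, for which [v_gain] is the required price
     condition. *)
  rewrite -ler_pdivrMl // (mulrA rho^-1).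
  apply: covering_lower_bound covQ => // [s s_gt0|].
    by rewrite -mulrA ler_pdivrMl // v_gain.
  by rewrite mulr_ge0 // invr_ge0 ltW.
apply: (le_trans le_P).
(* The coefficient 2/3 is the reciprocal of 3/2, the largest possible [rho]. *)
have cost_ge : (1 + 2 / 3 * eps) * (rho * cost alpha beta Q) <=
    (rho + eps) * cost alpha beta Q.
  have : 0 <= cost alpha beta Q.
    by rewrite /cost path_lengthE addr_ge0 ?mulr_ge0 ?len_ge0.
  by move=> /(mulr_ge0 (ltW eps_gt0)) => H; have := mulr_ge0 H (_ : 0 <= 1 - 2 / 3 * rho); lra.
apply: le_trans cost_ge.
have eps_ge0 : 0 <= 1 + 2 / 3 * eps by lra.
apply: le_trans (ler_wpM2l eps_ge0 le_Q).
have le_KK : 100 * k%:R ^+ 2 <= eps * (n%:R * m%:R).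
  by rewrite mulrA (le_trans large) // ler_peMr ?mulr_ge0 ?(ltW eps_gt0) // ler1n.
have M_ge0 : 0 <= n%:R * m%:R :> R by rewrite mulr_ge0.
(* By [le_KK], 4k^2 is at most eps n m / 25, so the surplus 2/3 eps absorbs both this loss and the
   3/10 eps of the upper bound. *)
have key : 2 * (n%:R * m%:R * (1 + 3 / 10 * eps)) <=
    (1 + 2 / 3 * eps) * (2 * (n%:R * m%:R) - 4 * k%:R ^+ 2).
  have := ler_wpM2l eps_ge0 le_KK.
  have epsM := mulr_ge0 (ltW eps_gt0) M_ge0.
  by have := mulr_ge0 epsM (_ : 0 <= 1 - eps); lra.
by have := ler_wpM2l v_ge0 key; lra.
Qed.
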